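(* A graph $G$ satisfies $\gamma_{r2}(H)=\gamma_R(H)$ for every induced subgraph $H$ of $G$ if and only if $G$ is $\{P_5,C_5,C_4\}$-free.
   Context: All graphs are finite, simple and undirected. A $2$-rainbow dominating function of a graph $G$ is a function $f:V(G)\to 2^{\{1,2\}}$ such that $\bigcup_{v\in N_G(u)} f(v)=\{1,2\}$ for every vertex $u$ with $f(u)=\emptyset$; its weight is $\sum_{u\in V(G)}|f(u)|$, and $\gamma_{r2}(G)$ is the minimum weight of a $2$-rainbow dominating function of $G$. A Roman dominating function of $G$ is a function $g:V(G)\to\{0,1,2\}$ such that every vertex $u$ with $g(u)=0$ has a neighbor $v$ with $g(v)=2$; its weight is $\sum_{u\in V(G)} g(u)$, and $\gamma_R(G)$ is the minimum weight of a Roman dominating function of $G$. $P_5$ is the path on $5$ vertices, $C_n$ the cycle on $n$ vertices; $G$ is $\{P_5,C_5,C_4\}$-free if it has no induced subgraph isomorphic to $P_5$, $C_5$ or $C_4$. *)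

(* Defs.v *)
From mathcomp Require Import all_boot.

Set Implicit Arguments.
Unset Strict Implicit.
Unset Printing Implicit Defensive.

Record sgraph := SGraph {
  vertex :> finType;
  adj : rel vertex;
  adj_sym : symmetric adj;
  adj_irrefl : irreflexive adj
}.

Definition neighbors (G : sgraph) (u : G) : {set G} := [set v | adj u v].

Section Induced.
Variables (G : sgraph) (S : {set G}).

Definition induced_rel : rel {x : G | x \in S} :=
  fun x y => adj (val x) (val y).

Lemma induced_sym : symmetric induced_rel.
Proof. by move=> x y; rewrite /induced_rel adj_sym. Qed.

Lemma induced_irrefl : irreflexive induced_rel.
Proof. by move=> x; rewrite /induced_rel adj_irrefl. Qed.

Definition induced : sgraph := SGraph induced_sym induced_irrefl.
End Induced.

Definition isomorphic (G H : sgraph) : Prop :=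
  exists2 h : G -> H, bijective h & forall x y : G, adj (h x) (h y) = adj x y.

Definition induced_free (F G : sgraph) : Prop :=
  forall S : {set G}, ~ isomorphic (induced S) F.

Definition path_rel n : rel 'I_n :=
  fun i j => (i.+1 == j :> nat) || (j.+1 == i :> nat).

Lemma path_rel_sym n : symmetric (@path_rel n).
Proof. by move=> i j; rewrite /path_rel orbC. Qed.

Lemma path_rel_irrefl n : irreflexive (@path_rel n).
Proof. by move=> i; rewrite /path_rel orbb gtn_eqF. Qed.

Definition path_graph n : sgraph := SGraph (@path_rel_sym n) (@path_rel_irrefl n).

(* [ordS] is the cyclic successor on ['I_n]; the conjunct [i != j] only matters
   for n = 1. This is the cycle C_n for n >= 3. *)
Definition cycle_rel n : rel 'I_n :=
  fun i j => (i != j) && ((ordS i == j) || (ordS j == i)).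

Lemma cycle_rel_sym n : symmetric (@cycle_rel n).
Proof. by move=> i j; rewrite /cycle_rel eq_sym orbC. Qed.

Lemma cycle_rel_irrefl n : irreflexive (@cycle_rel n).
Proof. by move=> i; rewrite /cycle_rel eqxx. Qed.

Definition cycle_graph n : sgraph :=
  SGraph (@cycle_rel_sym n) (@cycle_rel_irrefl n).

(* The two colors 1, 2 are the elements of ['I_2]. *)
Definition rainbow2 (G : sgraph) (f : {ffun G -> {set 'I_2}}) : bool :=
  [forall u : G,
     (f u == set0) ==> (\bigcup_(v in neighbors u) f v == [set: 'I_2])].

Definition rainbow2_weight (G : sgraph) (f : {ffun G -> {set 'I_2}}) : nat :=
  \sum_(u : G) #|f u|.

(* The constant function with value [setT] is 2-rainbow dominating, so the
   minimum ranges over a nonempty set. *)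
Definition gamma_r2 (G : sgraph) : nat :=
  rainbow2_weight
    [arg min_(f < [ffun _ : G => [set: 'I_2]] | rainbow2 f) rainbow2_weight f].

(* Values 0, 1, 2 are the elements of ['I_3]. *)
Definition roman (G : sgraph) (g : {ffun G -> 'I_3}) : bool :=
  [forall u : G, (g u == 0 :> nat) ==>
     [exists v : G, (v \in neighbors u) && (g v == 2 :> nat)]].

Definition roman_weight (G : sgraph) (g : {ffun G -> 'I_3}) : nat :=
  \sum_(u : G) g u.

(* [ord_max : 'I_3] has value 2; the corresponding constant function is Roman
   dominating. *)
Definition gamma_R (G : sgraph) : nat :=
  roman_weight
    [arg min_(g < [ffun _ : G => (ord_max : 'I_3)] | roman g) roman_weight g].

(* Main.v *)
(** A Roman dominating function becomes 2-rainbow dominating by replacing the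
values 0, 1, 2 with the sets {}, {1}, {1,2}, so gamma_r2 <= gamma_R always
holds; the inequality is strict for P5, C5 and C4.

For the reverse inequality on a {P5,C5,C4}-free graph, let A and B be the sets
of vertices whose label contains 1, respectively 2, so that the weight is
|A| + |B|, and let D be the set of vertices with empty label. As long as D is
nonempty one can remove parts A0, B0 of A, B and give the value 2 to a set S
with 2|S| <= |A0| + |B0| that dominates A0, B0 and all their neighbors in D:
- if x lies in A and B, take A0 = B0 = S = {x};
- if x, v in A u B are adjacent and v dominates the D-neighbors of x, remove x
  and v and take S = {v};
- otherwise, in any induced P4 p-x-v-q all neighbors of p lie in N[x]; hence,
  if A u B is not independent, both colors among its non-isolated vertices
  dominate all these vertices and their D-neighbors, and the smaller color
  class serves as S;
- if A u B is independent and d in D has neighbors a in A and b in B, then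
  P5- and C4-freeness force d to dominate the D-neighbors of a and b, so one
  removes a and b and takes S = {d}.
When D is empty, the remaining vertices get the value 1. *)
Require Import Defs.
From mathcomp Require Import all_boot zify.

Set Implicit Arguments.
Unset Strict Implicit.
Unset Printing Implicit Defensive.

(** * Forbidden induced subgraphs as adjacency patterns on named vertices *)

Definition embeds (F G : sgraph) : Prop :=
  exists2 h : F -> G, injective h & forall x y, adj (h x) (h y) = adj x y.

Lemma isomorphic_sym (G H : sgraph) : isomorphic G H -> isomorphic H G.
Proof.
case=> h [k hK kK] adjh; exists k; first by exists h.
by move=> x y; rewrite -adjh !kK.
Qed.

Lemma induced_free_embeds (F G : sgraph) : induced_free F G -> ~ embeds F G.
Proof.
move=> freeF [h inj_h adjh]; pose S := h @: [set: F].
have hS x : h x \in S by exact: imset_f.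
apply: (freeF S); apply: isomorphic_sym.
exists (fun x => exist _ (h x) (hS x) : induced S); last by move=> x y; exact: adjh.
apply: inj_card_bij; first by move=> x y [/inj_h].
by rewrite card_sig (@eq_card _ _ (mem S)) // card_imset // cardsT.
Qed.

(** Into or out of such a graph, injectivity is cheap: a map from a twin-free graph that preserves
    and reflects adjacency cannot identify two vertices. P5 and C5 are twin-free. *)
Definition twin_free (G : sgraph) : Prop :=
  forall x y : G, adj x =1 adj y -> x = y.

Lemma twin_free_embeds (F G : sgraph) (h : F -> G) :
  twin_free F -> (forall x y, adj (h x) (h y) = adj x y) -> embeds F G.
Proof. by move=> tf adjh; exists h => // x y hxy; apply: tf => z; rewrite -!adjh hxy. Qed.

Lemma path5_twin_free : twin_free (path_graph 5).
Proof.
move=> i j eq_nbr; apply/eqP; move: (eq_nbr (inord 0)) (eq_nbr (inord 1))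
  (eq_nbr (inord 2)) (eq_nbr (inord 3)) (eq_nbr (inord 4)).
rewrite /= /path_rel !inordK //.
by case: i j {eq_nbr} => [[|[|[|[|[|//]]]]] ?] [[|[|[|[|[|//]]]]] ?].
Qed.

Lemma cycle5_twin_free : twin_free (cycle_graph 5).
Proof.
move=> i j eq_nbr; apply/eqP; move: (eq_nbr (inord 0)) (eq_nbr (inord 1))
  (eq_nbr (inord 2)) (eq_nbr (inord 3)) (eq_nbr (inord 4)).
rewrite /= /cycle_rel -!val_eqE /= !inordK //.
by case: i j {eq_nbr} => [[|[|[|[|[|//]]]]] ?] [[|[|[|[|[|//]]]]] ?].
Qed.

Lemma induced_free_P5 (G : sgraph) : induced_free (path_graph 5) G ->
  forall a b c d e : G, adj a b -> adj b c -> adj c d -> adj d e ->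
    ~~ adj a c -> ~~ adj a d -> ~~ adj a e -> ~~ adj b d -> ~~ adj b e ->
    ~~ adj c e -> False.
Proof.
move=> /induced_free_embeds free a b c d e ab bc cd de.
move=> /negPf ac /negPf ad /negPf ae /negPf bd /negPf be /negPf ce.
have := (adj_irrefl a, adj_irrefl b, adj_irrefl c, adj_irrefl d, adj_irrefl e).
move=> [[[[aa bb] cc] dd] ee].
pose h (i : path_graph 5) := nth a [:: a; b; c; d; e] (i : 'I_5).
have adjh i j : adj (h i) (h j) = adj i j.
  case: i j => [[|[|[|[|[|//]]]]] ?] [[|[|[|[|[|//]]]]] ?] //=;
    rewrite /h /path_rel /=; (by []) || (by rewrite adj_sym).
by apply: free; apply: twin_free_embeds adjh; exact: path5_twin_free.
Qed.

Lemma induced_free_C5 (G : sgraph) : induced_free (cycle_graph 5) G ->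
  forall a b c d e : G, adj a b -> adj b c -> adj c d -> adj d e -> adj e a ->
    ~~ adj a c -> ~~ adj a d -> ~~ adj b d -> ~~ adj b e -> ~~ adj c e -> False.
Proof.
move=> /induced_free_embeds free a b c d e ab bc cd de ea.
move=> /negPf ac /negPf ad /negPf bd /negPf be /negPf ce.
have := (adj_irrefl a, adj_irrefl b, adj_irrefl c, adj_irrefl d, adj_irrefl e).
move=> [[[[aa bb] cc] dd] ee].
pose h (i : cycle_graph 5) := nth a [:: a; b; c; d; e] (i : 'I_5).
have adjh i j : adj (h i) (h j) = adj i j.
  case: i j => [[|[|[|[|[|//]]]]] ?] [[|[|[|[|[|//]]]]] ?] //=;
    rewrite /h /cycle_rel -!val_eqE /=; (by []) || (by rewrite adj_sym).
by apply: free; apply: twin_free_embeds adjh; exact: cycle5_twin_free.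
Qed.

(** Opposite vertices of C4 are twins, so the adjacency pattern does not separate them; hence the
    explicit hypotheses [a != c] and [b != d]. *)
Lemma induced_free_C4 (G : sgraph) : induced_free (cycle_graph 4) G ->
  forall a b c d : G, adj a b -> adj b c -> adj c d -> adj d a ->
    ~~ adj a c -> ~~ adj b d -> a != c -> b != d -> False.
Proof.
move=> /induced_free_embeds free a b c d ab bc cd da.
move=> /negPf ac /negPf bd /eqP a_c /eqP b_d.
have := (adj_irrefl a, adj_irrefl b, adj_irrefl c, adj_irrefl d).
move=> [[[aa bb] cc] dd].
pose h (i : cycle_graph 4) := nth a [:: a; b; c; d] (i : 'I_4).
apply: free; exists h => [i j|i j].
  by case: i j => [[|[|[|[|//]]]] ?] [[|[|[|[|//]]]] ?];
     rewrite /h /= => E; apply: val_inj => //=; congruence.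
case: i j => [[|[|[|[|//]]]] ?] [[|[|[|[|//]]]] ?] //=;
  rewrite /h /cycle_rel -!val_eqE /=; (by []) || (by rewrite adj_sym).
Qed.

(** * Dominating functions and their minimum weights *)

Lemma rainbow2P (G : sgraph) (f : {ffun G -> {set 'I_2}}) :
  reflect (forall u, f u = set0 -> forall c, exists2 v, adj u v & c \in f v)
          (rainbow2 f).
Proof.
apply: (iffP forallP) => [f_dom u fu0 c|f_dom u].
  have /eqP/setP/(_ c) := implyP (f_dom u) (introT eqP fu0).
  by rewrite inE => /bigcupP[v]; rewrite inE; exists v.
apply/implyP => /eqP fu0; rewrite -subTset; apply/subsetP => c _.
by have [v uv cv] := f_dom u fu0 c; apply/bigcupP; exists v; rewrite ?inE.
Qed.

Lemma romanP (G : sgraph) (g : {ffun G -> 'I_3}) :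
  reflect (forall u, g u = 0 :> nat -> exists2 v, adj u v & g v = 2 :> nat)
          (roman g).
Proof.
apply: (iffP forallP) => [g_dom u gu0|g_dom u].
  have /existsP[v] := implyP (g_dom u) (introT eqP gu0).
  by rewrite inE => /andP[uv /eqP]; exists v.
apply/implyP => /eqP /g_dom[v uv gv].
by apply/existsP; exists v; rewrite inE uv gv.
Qed.

Lemma gamma_r2_le (G : sgraph) (f : {ffun G -> {set 'I_2}}) :
  rainbow2 f -> gamma_r2 G <= rainbow2_weight f.
Proof.
rewrite /gamma_r2; case: arg_minnP => [|g _ min_g]; last exact: min_g.
by apply/forallP => u; rewrite ffunE -cards_eq0 cardsT card_ord.
Qed.

Lemma gamma_r2_attained (G : sgraph) :
  exists2 f : {ffun G -> {set 'I_2}}, rainbow2 f & rainbow2_weight f = gamma_r2 G.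
Proof.
rewrite /gamma_r2; case: arg_minnP => [|f f_dom _]; last by exists f.
by apply/forallP => u; rewrite ffunE -cards_eq0 cardsT card_ord.
Qed.

Lemma gamma_R_le (G : sgraph) (g : {ffun G -> 'I_3}) :
  roman g -> gamma_R G <= roman_weight g.
Proof.
rewrite /gamma_R; case: arg_minnP => [|h _ min_h]; last exact: min_h.
by apply/forallP => u; rewrite ffunE.
Qed.

Lemma gamma_R_attained (G : sgraph) :
  exists2 g : {ffun G -> 'I_3}, roman g & roman_weight g = gamma_R G.
Proof.
rewrite /gamma_R; case: arg_minnP => [|f f_dom _]; last by exists f.
by apply/forallP => u; rewrite ffunE.
Qed.

(** * Invariance under isomorphism, and the general inequality *)

Lemma gamma_r2_isomorphic (G H : sgraph) :
  isomorphic G H -> gamma_r2 G <= gamma_r2 H.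
Proof.
case=> h [k hK kK] adjh; have [f f_dom <-] := gamma_r2_attained H.
pose f' : {ffun G -> {set 'I_2}} := [ffun u => f (h u)].
suff f'_dom : rainbow2 f'.
  apply: leq_trans (gamma_r2_le f'_dom) _.
  rewrite /rainbow2_weight [leqRHS](reindex h) /=; last by exists k => ? _.
  by under eq_bigr do rewrite ffunE.
apply/forallP => u; have := forallP f_dom (h u); rewrite ffunE.
case: eqP => //= _ /eqP/setP cover; apply/eqP/setP => c; rewrite -cover.
apply/bigcupP/bigcupP => -[v]; rewrite inE => uv cv.
  by exists (h v); [rewrite inE adjh | rewrite ffunE in cv].
by exists (k v); rewrite ?ffunE ?kK // inE -adjh kK.
Qed.

Lemma gamma_R_isomorphic (G H : sgraph) :
  isomorphic G H -> gamma_R G <= gamma_R H.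
Proof.
case=> h [k hK kK] adjh; have [f f_dom <-] := gamma_R_attained H.
pose f' : {ffun G -> 'I_3} := [ffun u => f (h u)].
suff f'_dom : roman f'.
  apply: leq_trans (gamma_R_le f'_dom) _.
  rewrite /roman_weight [leqRHS](reindex h) /=; last by exists k => ? _.
  by under eq_bigr do rewrite ffunE.
apply/forallP => u; have := forallP f_dom (h u); rewrite ffunE.
case: eqP => //= _ /existsP[v]; rewrite inE => /andP[uv v2].
by apply/existsP; exists (k v); rewrite inE ffunE -adjh kK uv.
Qed.

Lemma isomorphic_gamma_eq (G H : sgraph) : isomorphic G H ->
  gamma_r2 G = gamma_R G -> gamma_r2 H = gamma_R H.
Proof.
move=> iGH eqG; have iHG := isomorphic_sym iGH.
have := gamma_r2_isomorphic iGH; have := gamma_r2_isomorphic iHG.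
have := gamma_R_isomorphic iGH; have := gamma_R_isomorphic iHG.
lia.
Qed.

Lemma gamma_r2_le_gamma_R (G : sgraph) : gamma_r2 G <= gamma_R G.
Proof.
have [g g_dom <-] := gamma_R_attained G.
pose f : {ffun G -> {set 'I_2}} :=
  [ffun u => if g u == 2 :> nat then setT else if g u == 0 :> nat then set0 else [set ord0]].
have f_dom : rainbow2 f.
  apply/forallP => u; apply/implyP; rewrite ffunE => f0.
  have gu0 : g u == 0 :> nat.
    move: f0; case: ifP => _; first by rewrite -cards_eq0 cardsT card_ord.
    by case: ifP => // _; rewrite -cards_eq0 cards1.
  have /existsP[v /andP[uv v2]] := implyP (forallP g_dom u) gu0.
  by rewrite -subTset (bigcup_max v) // ffunE v2.
apply: leq_trans (gamma_r2_le f_dom) _; apply: leq_sum => u _.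
rewrite ffunE; case: ifP => [/eqP->|_]; first by rewrite cardsT card_ord.
by case: ifP => [_|]; rewrite ?cards0 ?cards1 // lt0n => ->.
Qed.

(** * Strict inequality for P5, C5 and C4 *)

Lemma big_ord5 (F : 'I_5 -> nat) : \sum_i F i =
  F (inord 0) + F (inord 1) + F (inord 2) + F (inord 3) + F (inord 4).
Proof.
rewrite !big_ord_recl big_ord0 addn0 !addnA.
by congr (_ + _ + _ + _ + _); congr F; apply: val_inj; rewrite /= inordK.
Qed.

Lemma big_ord4 (F : 'I_4 -> nat) : \sum_i F i =
  F (inord 0) + F (inord 1) + F (inord 2) + F (inord 3).
Proof.
rewrite !big_ord_recl big_ord0 addn0 !addnA.
by congr (_ + _ + _ + _); congr F; apply: val_inj; rewrite /= inordK.
Qed.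

Lemma gamma_r2_path5 : gamma_r2 (path_graph 5) <= 3.
Proof.
pose f : {ffun path_graph 5 -> {set 'I_2}} := [ffun i : 'I_5 =>
  nth set0 [:: [set ord0]; set0; [set ord_max]; set0; [set ord0]] i].
apply: (@leq_trans (rainbow2_weight f)); last first.
  by rewrite /rainbow2_weight big_ord5 !ffunE !inordK //= !cards1 !cards0.
apply: gamma_r2_le; apply/rainbow2P => u; rewrite ffunE => fu0 c.
(* The empty labels sit at 1 and 3; [nb k] is the neighbor of such a [k] that carries color [c]. *)
pose nb (k : nat) := if c == ord0 then if k == 1 then 0 else 4 else 2.
exists (inord (nb u)).
  rewrite /= /path_rel inordK /nb; last by do 2?case: ifP.
  case: u fu0 => [[|[|[|[|[|//]]]]] ?] /= /eqP; rewrite -?cards_eq0 ?cards1 //=;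
    by case: (c == ord0).
rewrite ffunE inordK /nb; last by do 2?case: ifP.
case: ifP => [/eqP->|c0]; first by case: ifP; rewrite inE.
by rewrite inE; case: c c0 {nb} => [[|[|//]] ?].
Qed.

Lemma gamma_r2_cycle5 : gamma_r2 (cycle_graph 5) <= 3.
Proof.
pose f : {ffun cycle_graph 5 -> {set 'I_2}} := [ffun i : 'I_5 =>
  nth set0 [:: [set ord0]; set0; [set ord_max]; set0; [set ord0]] i].
apply: (@leq_trans (rainbow2_weight f)); last first.
  by rewrite /rainbow2_weight big_ord5 !ffunE !inordK //= !cards1 !cards0.
apply: gamma_r2_le; apply/rainbow2P => u; rewrite ffunE => fu0 c.
pose nb (k : nat) := if c == ord0 then if k == 1 then 0 else 4 else 2.
exists (inord (nb u)).
  rewrite /= /cycle_rel -!val_eqE /= inordK /nb; last by do 2?case: ifP.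
  case: u fu0 => [[|[|[|[|[|//]]]]] ?] /= /eqP; rewrite -?cards_eq0 ?cards1 //=;
    by case: (c == ord0).
rewrite ffunE inordK /nb; last by do 2?case: ifP.
case: ifP => [/eqP->|c0]; first by case: ifP; rewrite inE.
by rewrite inE; case: c c0 {nb} => [[|[|//]] ?].
Qed.

Lemma gamma_r2_cycle4 : gamma_r2 (cycle_graph 4) <= 2.
Proof.
pose f : {ffun cycle_graph 4 -> {set 'I_2}} := [ffun i : 'I_4 =>
  nth set0 [:: [set ord0]; set0; [set ord_max]; set0] i].
apply: (@leq_trans (rainbow2_weight f)); last first.
  by rewrite /rainbow2_weight big_ord4 !ffunE !inordK //= !cards1 !cards0.
apply: gamma_r2_le; apply/rainbow2P => u; rewrite ffunE => fu0 c.
pose nb := if c == ord0 then 0 else 2.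
exists (inord nb).
  rewrite /= /cycle_rel -!val_eqE /= inordK /nb; last by case: ifP.
  case: u fu0 => [[|[|[|[|//]]]] ?] /= /eqP; rewrite -?cards_eq0 ?cards1 //=;
    by case: (c == ord0).
rewrite ffunE inordK /nb; last by case: ifP.
case: ifP => [/eqP->|c0]; first by rewrite inE.
by rewrite inE; case: c c0 {nb} => [[|[|//]] ?].
Qed.

Lemma gamma_R_path5 : 3 < gamma_R (path_graph 5).
Proof.
have [g /romanP g_dom <-] := gamma_R_attained (path_graph 5).
pose x k : nat := g (inord k : 'I_5).
(* The Roman condition in terms of the numbers [x 0], ..., [x 4]; its five instances leave the
   weight bound to linear arithmetic. *)
have dom k : k < 5 -> x k = 0 ->
    0 < k /\ x k.-1 = 2 \/ k.+1 < 5 /\ x k.+1 = 2.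
  move=> k5 /g_dom[v]; rewrite /= /path_rel inordK // => /orP[] /eqP kv gv2.
    by right; rewrite /x kv inord_val.
  by left; rewrite -kv /x inord_val.
rewrite /roman_weight big_ord5 -!/(x _).
have := dom 0 isT; have := dom 1 isT; have := dom 2 isT; have := dom 3 isT.
have := dom 4 isT; rewrite /=; lia.
Qed.

Lemma gamma_R_cycle5 : 3 < gamma_R (cycle_graph 5).
Proof.
have [g /romanP g_dom <-] := gamma_R_attained (cycle_graph 5).
pose x k : nat := g (inord k : 'I_5).
(* [(k + 4) %% 5] is the cyclic predecessor of [k]. *)
have dom k : k < 5 -> x k = 0 -> x (k.+1 %% 5) = 2 \/ x ((k + 4) %% 5) = 2.
  move=> k5 /g_dom[v]; rewrite /= /cycle_rel -!val_eqE /= inordK //.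
  move=> /andP[_ /orP[]] /eqP kv gv2; first by left; rewrite /x kv inord_val.
  right; rewrite (_ : _ %% 5 = v) /x ?inord_val //.
  by have := ltn_ord v; lia.
rewrite /roman_weight big_ord5 -!/(x _).
have := dom 0 isT; have := dom 1 isT; have := dom 2 isT; have := dom 3 isT.
have := dom 4 isT; rewrite /= /modn /=; lia.
Qed.

Lemma gamma_R_cycle4 : 2 < gamma_R (cycle_graph 4).
Proof.
have [g /romanP g_dom <-] := gamma_R_attained (cycle_graph 4).
pose x k : nat := g (inord k : 'I_4).
have dom k : k < 4 -> x k = 0 -> x (k.+1 %% 4) = 2 \/ x ((k + 3) %% 4) = 2.
  move=> k4 /g_dom[v]; rewrite /= /cycle_rel -!val_eqE /= inordK //.
  move=> /andP[_ /orP[]] /eqP kv gv2; first by left; rewrite /x kv inord_val.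
  right; rewrite (_ : _ %% 4 = v) /x ?inord_val //.
  by have := ltn_ord v; lia.
rewrite /roman_weight big_ord4 -!/(x _).
have := dom 0 isT; have := dom 1 isT; have := dom 2 isT; have := dom 3 isT.
rewrite /= /modn /=; lia.
Qed.

(** * Domination by vertex sets *)

Lemma card_sum_mem (T : finType) (A : {set T}) : #|A| = \sum_x (x \in A).
Proof. by rewrite -sum1_card big_mkcond; apply: eq_bigr => x _; case: (x \in A). Qed.

Definition dominates (G : sgraph) (S : {set G}) (u : G) : bool :=
  [exists v in S, (v == u) || adj v u].

Lemma dominatesP (G : sgraph) (S : {set G}) (u : G) :
  reflect (exists2 v, v \in S & (v == u) || adj v u) (dominates S u).
Proof. exact: exists_inP. Qed.

Lemma dominates_sub (G : sgraph) (S T : {set G}) (u : G) :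
  S \subset T -> dominates S u -> dominates T u.
Proof. by move=> /subsetP ST /dominatesP[v /ST vT uv]; apply/dominatesP; exists v. Qed.

Lemma dominates1 (G : sgraph) (v u : G) :
  dominates [set v] u = (v == u) || adj v u.
Proof.
apply/dominatesP/idP => [[w /set1P-> //]|vu]; by exists v; rewrite ?set11.
Qed.

(** * Reductions in {P5,C5,C4}-free graphs *)

Section Reduction.
Variable G : sgraph.
Implicit Types (A B D S T : {set G}) (a b c d p q u v w x z : G).

Hypothesis P5_free : induced_free (path_graph 5) G.
Hypothesis C5_free : induced_free (cycle_graph 5) G.
Hypothesis C4_free : induced_free (cycle_graph 4) G.

(** The path [p]-[x]-[v]-[q] is induced, as an edge [p]-[q] would close a C4. If [w] were outside
    N[x], it would not be adjacent to [v] (C4 [w]-[p]-[x]-[v]), so [w]-[p]-[x]-[v]-[q] would induce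
    a C5 or a P5, according to whether [w] and [q] are adjacent. *)
Lemma P4_end_nbr p x v q w : adj p x -> adj x v -> adj v q ->
  ~~ dominates [set v] p -> ~~ dominates [set x] q -> adj w p ->
  dominates [set x] w.
Proof.
rewrite !dominates1 !negb_or => px xv vq /andP[v_p vp] /andP[x_q xq] wp.
have pq : ~~ adj p q.
  apply/negP => pq; apply: (induced_free_C4 C4_free px xv vq _ _ xq) => //;
    first [by rewrite adj_sym | by rewrite eq_sym].
rewrite -[_ || _]negbK negb_or; apply/negP => /andP[x_w xw].
have wv : ~~ adj w v.
  apply/negP => wv; apply: (induced_free_C4 C4_free wp px xv) => //;
    first [by rewrite adj_sym | by rewrite eq_sym].
rewrite adj_sym in vp; rewrite adj_sym in xw.
have [wq|wq] := boolP (adj w q); last exact: (induced_free_P5 P5_free wp px xv vq).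
by apply: (induced_free_C5 C5_free wp px xv vq) => //; rewrite adj_sym.
Qed.

(* Giving [S] the value 2 pays for deleting [A0] from [A], [B0] from [B] and the
   closed neighborhood of [S] from [D]. *)
Definition reduction A B D A0 B0 S : Prop :=
  [/\ A0 \subset A, B0 \subset B, A0 :|: B0 != set0,
      2 * #|S| <= #|A0| + #|B0| &
      forall x, x \in A0 :|: B0 ->
        dominates S x /\ forall d, d \in D -> adj d x -> dominates S d].

Definition reducible A B D : Prop := exists A0 B0 S, reduction A B D A0 B0 S.

Lemma reducible_sym A B D : reducible A B D -> reducible B A D.
Proof.
move=> [A0 [B0 [S [sA sB nz w dom]]]]; exists B0, A0, S.
by split; rewrite // 1?setUC // addnC.
Qed.

Lemma reducible_meet A B D x : x \in A :&: B -> reducible A B D.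
Proof.
rewrite inE => /andP[xA xB]; exists [set x], [set x], [set x].
split; rewrite ?sub1set ?setUid ?cards1 // -?cards_eq0 ?cards1 //.
move=> _ /set1P ->; rewrite dominates1 eqxx; split=> // d _ dx.
by rewrite dominates1 adj_sym dx orbT.
Qed.

Lemma reducible_edge A B D x v : x \in A :|: B -> v \in A :|: B -> adj x v ->
  (forall d, d \in D -> adj d x -> dominates [set v] d) -> reducible A B D.
Proof.
move=> xW vW xv dom; pose X := [set x; v].
have x_v : x != v by apply: contraTneq xv => ->; rewrite adj_irrefl.
(* The colors of [x] and [v] are arbitrary, but the two traces on [X] cover both vertices, so their
   sizes sum to at least 2. *)
have UI : (A :&: X) :|: (B :&: X) = X.
  rewrite -setIUl; apply/setIidPr/subsetP => y.
  by rewrite !inE => /orP[]/eqP->; rewrite -in_setU.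
exists (A :&: X), (B :&: X), [set v]; split; rewrite ?subsetIl ?UI //.
- by rewrite -cards_eq0 cards2 x_v.
- by rewrite cards1 -cardsUI UI cards2 x_v leq_addr.
move=> y /set2P[]->; rewrite dominates1.
  by split; [rewrite adj_sym xv orbT | exact: dom].
rewrite eqxx; split=> // d _ dv.
by rewrite dominates1 adj_sym dv orbT.
Qed.

(** The rainbow condition in terms of color classes; [D] is kept separate because it shrinks during
    the induction. *)
Definition bicolored A B D : Prop := forall d, d \in D ->
  (exists2 a, a \in A & adj d a) /\ (exists2 b, b \in B & adj d b).

Lemma bicolored_sym A B D : bicolored A B D -> bicolored B A D.
Proof. by move=> col d /col[]. Qed.

(* Otherwise [b], [d], [a], [p] and a neighbor of [p] in [B] would form an
   induced P5. *)
Lemma independent_nbr A B D a b d p : bicolored A B D ->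
  {in A :|: B &, forall x y, ~~ adj x y} -> [disjoint A & B] ->
  a \in A -> b \in B -> adj d a -> adj d b -> p \in D -> adj p a -> dominates [set d] p.
Proof.
move=> col indep dis aA bB da db pD pa.
have a_b : a != b by apply: contraTneq bB => <-; rewrite (disjointFr dis).
have [_ [b' b'B pb']] := col p pD.
have [aW bW b'W] : [/\ a \in A :|: B, b \in A :|: B & b' \in A :|: B].
  by rewrite !inE aA bB b'B !orbT.
rewrite dominates1 -[_ || _]negbK negb_or; apply/negP => /andP[d_p dp].
(* Chords of the P5: [p]-[b] would close the C4 [p]-[a]-[d]-[b], and [d]-[b'] the C4
   [d]-[a]-[p]-[b']. Independence and the choice of [p] exclude the others. *)
have pb : ~~ adj p b.
  apply/negP => pb; apply: (induced_free_C4 C4_free pa _ db) => //;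
    first [exact: indep | by rewrite adj_sym | by rewrite eq_sym].
have a_b' : a != b' by apply: contraTneq b'B => <-; rewrite (disjointFr dis).
have db' : ~~ adj d b'.
  apply/negP => db'; apply: (induced_free_C4 C4_free da _ pb') => //;
    first [exact: indep | by rewrite adj_sym | by rewrite eq_sym].
have bd : adj b d by rewrite adj_sym.
have ap : adj a p by rewrite adj_sym.
apply: (induced_free_P5 P5_free bd da ap pb') => //;
  first [exact: indep | by rewrite adj_sym].
Qed.

Lemma reducible_independent A B D d : bicolored A B D ->
  {in A :|: B &, forall x y, ~~ adj x y} -> [disjoint A & B] -> d \in D ->
  reducible A B D.
Proof.
move=> col indep dis dD; have [[a aA da] [b bB db]] := col d dD.
have a_b : a != b by apply: contraTneq bB => <-; rewrite (disjointFr dis).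
exists [set a], [set b], [set d]; split; rewrite ?sub1set ?cards1 //.
  by rewrite -cards_eq0 cards2 a_b.
have colS := bicolored_sym col; move=> x /set2P[]->; rewrite dominates1 ?da ?db orbT.
  by split=> // p pD pa; apply: (independent_nbr col indep dis aA bB).
split=> // p pD pb; apply: (independent_nbr colS _ _ bB aA) => //.
  by rewrite setUC.
by rewrite disjoint_sym.
Qed.

(** * Edges between colored vertices whose ends have private neighbors *)

Section Private.
Variables A B D : {set G}.
Hypothesis col : bicolored A B D.
Hypothesis dis : [disjoint A & B].
(** The situation in which [reducible_edge] applies to no edge. Used in both directions, it makes
    every edge inside [A :|: B] the middle of an induced P4 with ends in [D]. *)
Hypothesis private : forall x v, x \in A :|: B -> v \in A :|: B -> adj x v ->
  exists2 d, d \in D & adj d x && ~~ dominates [set v] d.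

Let touching := [set x in A :|: B | [exists z in A :|: B, adj x z]].

(** A private neighbor [q] of [v] completes the path [d]-[x]-[v]-[q] of [P4_end_nbr]. *)
Lemma private_nbr x v d w : x \in A :|: B -> v \in A :|: B -> adj x v ->
  adj d x -> ~~ dominates [set v] d -> adj d w -> dominates [set x] w.
Proof.
move=> xW vW xv dx vd dw; have vx : adj v x by rewrite adj_sym.
have [q _ /andP[qv xq]] := private vW xW vx.
by apply: (P4_end_nbr dx xv _ vd xq); rewrite adj_sym.
Qed.

(** If the neighbor [z] of [b] is not in [A], a private neighbor [p] of [b] has a neighbor in [A],
    which lies in N[b] by [private_nbr] and differs from [b] by disjointness. *)
Lemma touching_other b : b \in B -> b \in touching ->
  exists2 a, a \in A & adj b a.
Proof.
rewrite inE => bB /andP[bW /exists_inP[z zW bz]].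
have [zA|zA] := boolP (z \in A); first by exists z.
have [p pD /andP[pb zp]] := private bW zW bz.
have [[a aA pa] _] := col pD; exists a => //.
have := private_nbr bW zW bz pb zp pa; rewrite dominates1 => /orP[/eqP ba|//].
by rewrite -ba (disjointFl dis) in aA.
Qed.

Lemma touchingI x z : x \in A :|: B -> z \in A :|: B -> adj x z -> x \in touching.
Proof. by move=> xW zW xz; rewrite inE xW; apply/exists_inP; exists z. Qed.

(** Take a neighbor [a] of [b] in [A]. If [a] does not dominate [d], then all neighbors of [d] lie
    in N[b]; so a neighbor of [d] in [A] is adjacent to [b], hence touching. *)
Lemma touching_dominates b d : b \in B -> b \in touching -> d \in D ->
  adj d b -> dominates (A :&: touching) d.
Proof.
move=> bB bT dD db; have [a aA ba] := touching_other bB bT.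
have bW : b \in A :|: B by rewrite inE bB orbT.
have inT a' : a' \in A -> adj b a' -> a' \in A :&: touching.
  move=> aA' ba'; rewrite inE aA' (@touchingI a' b) //; first by rewrite inE aA'.
  by rewrite adj_sym.
have [|ad] := boolP (dominates [set a] d).
  by apply: dominates_sub; rewrite sub1set inT.
have aW : a \in A :|: B by rewrite inE aA.
have [[a' aA' da'] _] := col dD.
have := private_nbr bW aW ba db ad da'; rewrite dominates1 => /orP[/eqP bE|ba'].
  by rewrite -bE (disjointFl dis) in aA'.
apply/dominatesP; exists a'; first exact: inT.
by rewrite adj_sym da' orbT.
Qed.

Lemma reducible_touching x : x \in touching ->
  #|A :&: touching| <= #|B :&: touching| -> reducible A B D.
Proof.
move=> xT leAB; exists (A :&: touching), (B :&: touching), (A :&: touching).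
split; rewrite ?subsetIl //.
- by apply/set0Pn; exists x; rewrite -setIUl in_setI xT; move: xT; rewrite inE => /andP[->].
- by rewrite mul2n -addnn leq_add2l.
(* Vertices of [A :&: touching] dominate their own closed neighborhoods; only those of [B] require
   the preceding lemmas. *)
move=> y /setUP[yT|/setIP[yB yT]]; last first.
  split; last by move=> d dD; apply: touching_dominates dD.
  have [a aA ya] := touching_other yB yT.
  have ay : adj a y by rewrite adj_sym.
  apply/dominatesP; exists a; last by rewrite ay orbT.
  by rewrite inE aA (@touchingI a y) // inE ?aA ?yB ?orbT.
split; first by apply/dominatesP; exists y; rewrite ?eqxx.
by move=> d _ dy; apply/dominatesP; exists y; rewrite // adj_sym dy orbT.
Qed.

End Private.

(** * From reductions to a Roman dominating function *)

Lemma reducible_bicolored A B D : bicolored A B D -> D != set0 -> reducible A B D.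
Proof.
move=> col /set0Pn[d dD].
have [dis|] := boolP [disjoint A & B]; last first.
  by rewrite -setI_eq0 => /set0Pn[x]; apply: reducible_meet.
have [indep|] := boolP [forall x in A :|: B, forall y in A :|: B, ~~ adj x y].
  apply: reducible_independent dD => // x y xW yW.
  by move/forall_inP/(_ x xW)/forall_inP: indep; apply.
move=> /forall_inPn[x xW /forall_inPn[y yW /negbNE xy]].
pose shared u v := [forall d in D, adj d u ==> dominates [set v] d].
have [/exists_inP[u uW /exists_inP[v vW /andP[uv /forall_inP dom]]]|none] :=
  boolP [exists u in A :|: B, exists v in A :|: B, adj u v && shared u v].
  by apply: (reducible_edge uW vW uv) => p /dom/implyP.
have private u v : u \in A :|: B -> v \in A :|: B -> adj u v ->
    exists2 d, d \in D & adj d u && ~~ dominates [set v] d.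
  move=> uW vW uv; have : ~~ shared u v.
    apply: contra none => sh; apply/exists_inP; exists u => //.
    by apply/exists_inP; exists v; rewrite ?uv.
  by move=> /forall_inPn[p pD]; rewrite negb_imply; exists p.
have dis' : [disjoint B & A] by rewrite disjoint_sym.
have colS := bicolored_sym col.
pose T := [set x in A :|: B | [exists z in A :|: B, adj x z]].
have xT : x \in T by rewrite inE xW; apply/exists_inP; exists y.
(* The smaller class receives the value 2; the second case exchanges the colors. *)
case: (leqP #|A :&: T| #|B :&: T|) => [leAB|/ltnW leBA].
  exact: (reducible_touching col dis private xT leAB).
apply: reducible_sym; rewrite /T (setUC A) in xT leBA private.
exact: (reducible_touching colS dis' private xT leBA).
Qed.

(** [S] is to receive the value 2 and [T] the value 1. The induction is on the weight [#|A| + #|B|],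
    which every reduction lowers. *)
Lemma bicolored_roman A B D : bicolored A B D -> exists S T,
  2 * #|S| + #|T| <= #|A| + #|B| /\
  forall u, u \in A :|: B :|: D -> (u \in T) || dominates S u.
Proof.
have [n] := ubnP (#|A| + #|B|); elim: n => // n IHn in A B D * => leABn col.
have [D0|nzD] := eqVneq D set0.
  exists set0, (A :|: B); rewrite cards0 -cardsUI leq_addr; split=> // u.
  by rewrite D0 setU0 => ->.
have [A0 [B0 [S0 [sA sB nz w0 dom]]]] := reducible_bicolored col nzD.
pose D' := [set d in D | ~~ dominates S0 d].
have cA := cardsDS sA; have cB := cardsDS sB.
have lA := subset_leq_card sA; have lB := subset_leq_card sB.
have lt0 : 0 < #|A0| + #|B0|.
  by rewrite -cardsUI addn_gt0 card_gt0 nz.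
have ltn' : #|A :\: A0| + #|B :\: B0| < n by lia.
(* A vertex of [D] adjacent to a deleted one is dominated by [S0] and has left [D'], so the vertices
   of [D'] keep all their colored neighbors. *)
have col' : bicolored (A :\: A0) (B :\: B0) D'.
  move=> d; rewrite inE => /andP[dD dS]; have [[a aA da] [b bB db]] := col d dD.
  have far x : x \in A0 :|: B0 -> ~~ adj d x.
    by move=> /dom[_ near]; apply: contra dS; exact: near.
  split; [exists a | exists b] => //; rewrite inE ?aA ?bB andbT.
    by apply: contraL da => aA0; rewrite far // inE aA0.
  by apply: contraL db => bB0; rewrite far // inE bB0 orbT.
have [S [T [w cover]]] := IHn _ _ _ ltn' col'.
exists (S0 :|: S), T; split; first by have [leS _] := leq_card_setU S0 S; lia.
move=> u uABD; have [uS|uS] := boolP (dominates S0 u).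
  by rewrite (dominates_sub (subsetUl _ _) uS) orbT.
have u0 : u \notin A0 :|: B0 by apply: contra uS => /dom[].
have : u \in (A :\: A0) :|: (B :\: B0) :|: D'.
  move: uABD u0; rewrite !inE uS andbT negb_or => uABD /andP[-> ->] /=.
  by [].
move=> /cover /orP[->//|uS']; by rewrite (dominates_sub (subsetUr _ _) uS') orbT.
Qed.

Lemma gamma_R_le_gamma_r2 : gamma_R G <= gamma_r2 G.
Proof.
have [f /rainbow2P f_dom <-] := gamma_r2_attained G.
pose A := [set u | ord0 \in f u]; pose B := [set u | ord_max \in f u].
(* The complement of [A :|: B] is the set of empty labels; with it, the cover below reaches every
   vertex. *)
have col : bicolored A B (~: (A :|: B)).
  move=> u; rewrite !inE negb_or => /andP[u0 u1].
  have fu0 : f u = set0.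
    apply/setP => c; rewrite inE; apply/negbTE.
    have [->|->] // : c = ord0 \/ c = ord_max.
    by case: c => [[|[|//]] ?]; [left | right]; apply: val_inj.
  have [v uv vA] := f_dom u fu0 ord0; have [w uw wB] := f_dom u fu0 ord_max.
  by split; [exists v | exists w]; rewrite ?inE.
have [S [T [wST cover]]] := bicolored_roman col.
pose g : {ffun G -> 'I_3} :=
  [ffun u => if u \in S then inord 2 else if u \in T then inord 1 else inord 0].
have gE u : g u = (if u \in S then 2 else u \in T) :> nat.
  by rewrite ffunE; do 2?case: ifP => _; rewrite inordK.
have g_dom : roman g.
  apply/romanP => u; rewrite gE; case: ifP => // uS /eqP; rewrite eqb0 => uT.
  have := cover u; rewrite setUCr inE (negPf uT) => /(_ isT) /dominatesP[v vS].
  case/predU1P => [vu|vu]; first by rewrite -vu vS in uS.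
  by exists v; rewrite ?gE ?vS // adj_sym.
(* The weight of [g] is at most [2 * #|S| + #|T|], an overlap of [S] and [T] only lowering it;
   [#|A| + #|B|] is bounded by the weight of [f] vertex by vertex. *)
apply: leq_trans (gamma_R_le g_dom) _; apply: leq_trans.
  apply: leq_trans wST; rewrite !card_sum_mem big_distrr -big_split /=.
  by apply: leq_sum => u _; rewrite gE; do 2?case: (u \in _).
rewrite !card_sum_mem -big_split /=; apply: leq_sum => u _.
rewrite card_sum_mem !big_ord_recl big_ord0 addn0 !inE.
by rewrite leq_add2l (_ : lift _ _ = ord_max) //; apply: val_inj.
Qed.

End Reduction.

(** * Passage to induced subgraphs and the characterization *)

Lemma induced_free_induced (F G : sgraph) (S : {set G}) :
  induced_free F G -> induced_free F (induced S).
Proof.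
move=> freeF T [h [k hK kK] adjh]; apply: (induced_free_embeds freeF).
exists (fun x => val (val (k x))) => [x y /val_inj/val_inj/(can_inj kK)//|x y].
by rewrite -[in RHS](kK x) -[in RHS](kK y) adjh.
Qed.

Theorem theorem4 (G : sgraph) :
  (forall S : {set G}, gamma_r2 (induced S) = gamma_R (induced S)) <->
  [/\ induced_free (path_graph 5) G,
      induced_free (cycle_graph 5) G &
      induced_free (cycle_graph 4) G].
Proof.
split=> [eq_gamma|[P5 C5 C4] S].
  (* An induced copy would transfer the equality to P5, C5 or C4, where it fails. *)
  split=> S /isomorphic_gamma_eq/(_ (eq_gamma S)).
  - by have := gamma_r2_path5; have := gamma_R_path5; lia.
  - by have := gamma_r2_cycle5; have := gamma_R_cycle5; lia.
  - by have := gamma_r2_cycle4; have := gamma_R_cycle4; lia.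
apply/eqP; rewrite eqn_leq gamma_r2_le_gamma_R.
by apply: gamma_R_le_gamma_r2; exact: induced_free_induced.
Qed.
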